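(* Let $M$ and $N$ be ld-spaces, let $C\subseteq M$ be a definable subspace that is closed in $M$, and let $\theta:M\rightarrow N$ be an ld-covering map. Then $\theta(C)\subseteq N$ is a definable subspace that is closed in $N$.
   Context: Work in a sufficiently saturated o-minimal expansion of a real closed field $R$ ($\kappa$-saturated for some sufficiently large cardinal $\kappa$); ''definable'' refers to this structure, with parameters. A locally definable space is a triple $(M,(M_i,\phi_i)_{i\in I})$ where $M=\bigcup_{i\in I}M_i$, each $\phi_i:M_i\to Z_i$ is a bijection onto a definable set $Z_i\subseteq R^{n(i)}$, each $\phi_i(M_i\cap M_j)$ is a definable relatively open subset of $Z_i$, and the transition maps $\phi_j\circ\phi_i^{-1}:\phi_i(M_i\cap M_j)\to\phi_j(M_i\cap M_j)$ are definable homeomorphisms. Its topology is the unique one making each $M_i$ open and each $\phi_i$ a homeomorphism. An ld-space is a Hausdorff locally definable space. A subset $X\subseteq M$ is a definable subspace if there is a finite $J\subseteq I$ with $X\subseteq\bigcup_{j\in J}M_j$ and $\phi_j(X\cap M_j)$ definable for all $j\in J$. A subset $Y\subseteq M$ is a compatible subspace if $\phi_i(Y\cap M_i)$ is definable for all $i\in I$; compatible subspaces are themselves ld-spaces with charts $(Y\cap M_i,\phi_i|_{Y\cap M_i})$. A map between definable subspaces is definable if its graph is a definable subspace of the product. A map $\theta:M\to N$ of ld-spaces is an ld-map if for every $i\in I$, $\theta(M_i)$ is a definable subspace of $N$ and $\theta|_{M_i}:M_i\to\theta(M_i)$ is definable. An ld-space is connected if it has no nonempty proper clopen compatible subspace;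 connected components are the path connected components, for continuous ld-maps $[0,1]\to M$. An ld-covering map is a surjective continuous ld-map $\theta:M\to N$, where $N$ has charts $(N_j,\psi_j)_{j\in J}$, for which there is a family $\{\mathcal{O}_l:l\in L\}$ of open definable subspaces of $N$ such that (i) $N=\bigcup_{l\in L}\mathcal{O}_l$; (ii) for every $j\in J$ the cover $\{\mathcal{O}_l\cap N_j:l\in L\}$ of $N_j$ admits a finite subcover; (iii) for every $l\in L$ and each connected component $C$ of $\theta^{-1}(\mathcal{O}_l)$, the restriction $\theta|_C:C\to\mathcal{O}_l$ is a definable homeomorphism (in particular $C$ and $\theta|_C$ are definable). *)

(* Defs.v *)
From HB Require Import structures.
From mathcomp Require Import all_boot all_order all_algebra.
From mathcomp Require Import all_classical all_reals all_analysis.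
Set Implicit Arguments.
Unset Strict Implicit.
Unset Printing Implicit Defensive.
Import Order.TTheory GRing.Theory Num.Theory.
Import numFieldNormedType.Exports.
Local Open Scope classical_set_scope.
Local Open Scope ring_scope.
Local Open Scope card_scope.

(* ** First-order expansions of a real closed field *)

(* The symbols added to the language {0, 1, +, -, *, <} of ordered rings, which
   is built into [term] and [formula] below. *)
Record language := Language {
  fsym : Type;
  farity : fsym -> nat;
  rsym : Type;
  rarity : rsym -> nat }.

Record expansion (R : rcfType) (L : language) := Expansion {
  finterp : forall f : fsym L, 'rV[R]_(farity f) -> R;
  rinterp : forall r : rsym L, set 'rV[R]_(rarity r) }.

(* Terms and formulas with parameters from R and free variables indexed
   by 'I_n; [Ex] binds variable 0 of its argument. *)
Inductive term (R : rcfType) (L : language) (n : nat) : Type :=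
  | Var of 'I_n
  | Par of R
  | Zero
  | One
  | Opp of term R L n
  | Add of term R L n & term R L n
  | Mul of term R L n & term R L n
  | App (f : fsym L) of ('I_(farity f) -> term R L n).

Inductive formula (R : rcfType) (L : language) : nat -> Type :=
  | Eq n of term R L n & term R L n : formula R L n
  | Lt n of term R L n & term R L n : formula R L n
  | Rel n (r : rsym L) of ('I_(rarity r) -> term R L n) : formula R L n
  | Neg n of formula R L n : formula R L n
  | And n of formula R L n & formula R L n : formula R L n
  | Ex n of formula R L n.+1 : formula R L n.

Fixpoint teval (R : rcfType) (L : language) (S : expansion R L) (n : nat)
    (x : 'rV[R]_n) (t : term R L n) : R :=
  match t with
  | Var i => x ord0 i
  | Par a => a
  | Zero => 0
  | One => 1
  | Opp t1 => - teval S x t1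
  | Add t1 t2 => teval S x t1 + teval S x t2
  | Mul t1 t2 => teval S x t1 * teval S x t2
  | App f ts => finterp S (\row_i teval S x (ts i))
  end.

Fixpoint holds (R : rcfType) (L : language) (S : expansion R L) (n : nat)
    (phi : formula R L n) : 'rV[R]_n -> Prop :=
  match phi in formula _ _ m return 'rV[R]_m -> Prop with
  | Eq _ t1 t2 => fun x => teval S x t1 = teval S x t2
  | Lt _ t1 t2 => fun x => teval S x t1 < teval S x t2
  | Rel _ r ts => fun x => rinterp S (\row_i teval S x (ts i))
  | Neg _ f => fun x => ~ holds S f x
  | And _ f g => fun x => holds S f x /\ holds S g x
  | Ex m f => fun x =>
      exists a : R, holds S f (row_mx (const_mx a : 'rV[R]_1) x : 'rV[R]_(1 + m))
  end.

Fixpoint term_over (R : rcfType) (L : language) (A : set R) (n : nat)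
    (t : term R L n) : Prop :=
  match t with
  | Par a => A a
  | Opp t1 => term_over A t1
  | Add t1 t2 | Mul t1 t2 => term_over A t1 /\ term_over A t2
  | App f ts => forall i, term_over A (ts i)
  | _ => True
  end.

Fixpoint formula_over (R : rcfType) (L : language) (A : set R) (n : nat)
    (phi : formula R L n) : Prop :=
  match phi with
  | Eq _ t1 t2 | Lt _ t1 t2 => term_over A t1 /\ term_over A t2
  | Rel _ r ts => forall i, term_over A (ts i)
  | Neg _ f | Ex _ f => formula_over A f
  | And _ f g => formula_over A f /\ formula_over A g
  end.

Definition definable (R : rcfType) (L : language) (S : expansion R L) (n : nat)
    (X : set 'rV[R]_n) : Prop :=
  exists phi : formula R L n, X = [set x | holds S phi x].

(* Points are the intervals `[a, a]; endpoints may be infinite. *)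
Definition o_minimal (R : rcfType) (L : language) (S : expansion R L) : Prop :=
  forall X : set 'rV[R]_1, definable S X ->
    exists s : seq (interval R),
      [set t : R | X (const_mx t)] = [set t | has (fun I => t \in I) s].

(* kappa-saturation for kappa = |K|: every finitely satisfiable 1-type over
   fewer than kappa parameters is realized. *)
Definition saturated (R : rcfType) (L : language) (S : expansion R L)
    (K : Type) : Prop :=
  forall A : set R, ~ ([set: K] #<= A) ->
  forall p : set (formula R L 1), (forall phi, p phi -> formula_over A phi) ->
    (forall q : set (formula R L 1), finite_set q -> q `<=` p ->
       exists a : R, forall phi, q phi -> holds S phi (const_mx a)) ->
    exists a : R, forall phi, p phi -> holds S phi (const_mx a).

(* ** Homeomorphisms between subsets *)

(* Stated without an inverse function because the ambient type X may be empty
   when A is. *)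
Definition homeo_on (X Y : topologicalType) (A : set X) (B : set Y)
    (f : X -> Y) : Prop :=
  [/\ set_bij A B f,
      {within A, continuous f} &
      forall V : set X, V `<=` A -> open (V : set (subspace A)) ->
        open (f @` V : set (subspace B))].

Definition definable_homeo (R : rcfType) (L : language) (S : expansion R L)
    (m n : nat) (A : set 'rV[R]_m) (B : set 'rV[R]_n)
    (f : 'rV[R]_m -> 'rV[R]_n) : Prop :=
  homeo_on A B f /\ definable S [set row_mx z (f z) | z in A].

(* ** Locally definable spaces *)

(* [chart i] is a total function on X, but only its values on [dom i] matter.
   The charts need not cover X: an atlas may describe a subset of X. *)
Record atlas (R : rcfType) (X : Type) := Atlas {
  idx : Type;
  dom : idx -> set X;
  dim : idx -> nat;
  chart : forall i : idx, X -> 'rV[R]_(dim i) }.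
Arguments idx {R X}.
Arguments dom {R X}.
Arguments dim {R X}.
Arguments chart {R X}.

Definition chart_img (R : rcfType) (X : Type) (a : atlas R X) (i : idx a) :
    set 'rV[R]_(dim a i) :=
  chart a i @` dom a i.
Arguments chart_img {R X} a i.

(* phi_j o phi_i^-1 on phi_i (M_i cap M_j), and 0 elsewhere *)
Definition transition (R : rcfType) (X : Type) (a : atlas R X) (i j : idx a)
    (z : 'rV[R]_(dim a i)) : 'rV[R]_(dim a j) :=
  xget 0 [set chart a j x | x in dom a i `&` dom a j `&` chart a i @^-1` [set z]].
Arguments transition {R X} a i j z.

Definition locally_definable (R : rcfType) (L : language) (S : expansion R L)
    (X : Type) (a : atlas R X) : Prop :=
  [/\ [set: X] = \bigcup_i dom a i,
      forall i, {in dom a i &, injective (chart a i)},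
      forall i, definable S (chart_img a i),
      forall i j, let Zij := chart a i @` (dom a i `&` dom a j) in
        definable S Zij /\ open (Zij : set (subspace (chart_img a i))) &
      forall i j,
        definable_homeo S (chart a i @` (dom a i `&` dom a j))
          (chart a j @` (dom a i `&` dom a j)) (transition a i j)].

(* The topology of the carrier is pinned down by [ld_dom_open] and
   [ld_chart_homeo]. *)
Record ld_space (R : rcfType) (L : language) (S : expansion R L) := LdSpace {
  carrier :> topologicalType;
  charts : atlas R carrier;
  ld_charts : locally_definable S charts;
  ld_dom_open : forall i, open (dom charts i);
  ld_chart_homeo : forall i,
    homeo_on (dom charts i) (chart_img charts i) (chart charts i);
  ld_hausdorff : hausdorff_space carrier }.

Definition definable_subspace (R : rcfType) (L : language) (S : expansion R L)
    (X : Type) (a : atlas R X) (Y : set X) : Prop :=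
  exists J : set (idx a),
    [/\ finite_set J,
        Y `<=` \bigcup_(j in J) dom a j &
        forall j, J j -> definable S (chart a j @` (Y `&` dom a j))].

Definition restrict_atlas (R : rcfType) (X : Type) (a : atlas R X) (Y : set X) :
    atlas R X :=
  Atlas (fun i => Y `&` dom a i) (chart a).

Definition prod_atlas (R : rcfType) (X Y : Type) (a : atlas R X)
    (b : atlas R Y) : atlas R (X * Y) :=
  @Atlas R (X * Y) (idx a * idx b)%type
    (fun ij => dom a ij.1 `*` dom b ij.2)
    (fun ij => (dim a ij.1 + dim b ij.2)%N)
    (fun ij xy => row_mx (chart a ij.1 xy.1) (chart b ij.2 xy.2)).

Definition unit_interval_atlas (R : rcfType) : atlas R R :=
  @Atlas R R unit (fun=> `[0, 1]%classic) (fun=> 1%N) (fun=> fun t => const_mx t).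

(* f restricted to A is definable *)
Definition definable_map (R : rcfType) (L : language) (S : expansion R L)
    (X Y : Type) (a : atlas R X) (b : atlas R Y) (A : set X) (f : X -> Y) : Prop :=
  definable_subspace S (prod_atlas a b) [set (x, f x) | x in A].

Definition ld_map (R : rcfType) (L : language) (S : expansion R L)
    (X Y : Type) (a : atlas R X) (b : atlas R Y) (f : X -> Y) : Prop :=
  forall i, definable_subspace S b (f @` dom a i) /\
            definable_map S a b (dom a i) f.

(* For Y compatible, [restrict_atlas (charts M) Y] is the atlas of Y as an
   ld-space, whose topology is the subspace topology. *)
Definition ld_path (R : rcfType) (L : language) (S : expansion R L)
    (M : ld_space S) (Y : set M) (x y : M) : Prop :=
  exists gamma : R -> M,
    [/\ ld_map S (unit_interval_atlas R) (restrict_atlas (charts M) Y) gamma,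
        {within `[0, 1]%classic, continuous gamma},
        gamma 0 = x &
        gamma 1 = y].

Definition connected_component_of (R : rcfType) (L : language)
    (S : expansion R L) (M : ld_space S) (Y D : set M) : Prop :=
  exists2 x, Y x & D = [set y | ld_path Y x y].

Definition ld_covering (R : rcfType) (L : language) (S : expansion R L)
    (M N : ld_space S) (theta : M -> N) : Prop :=
  [/\ set_surj [set: M] [set: N] theta,
      continuous theta,
      ld_map S (charts M) (charts N) theta &
      exists (I : Type) (O : I -> set N),
        [/\ forall l, open (O l) /\ definable_subspace S (charts N) (O l),
            [set: N] = \bigcup_l O l,
            forall j, exists2 I0 : set I, finite_set I0 &
              dom (charts N) j = \bigcup_(l in I0) (O l `&` dom (charts N) j) &
            forall l (D : set M), connected_component_of (theta @^-1` O l) D ->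
              [/\ definable_subspace S (charts M) D,
                  definable_map S (charts M) (charts N) D theta &
                  homeo_on D (O l) theta]]].

(* Main.v *)
Require Import Defs.
From mathcomp Require Import all_boot all_order all_algebra.
From mathcomp Require Import all_classical all_reals all_analysis.
From mathcomp Require Import lra.
Import numFieldNormedType.Exports.
Local Open Scope classical_set_scope.
Local Open Scope ring_scope.
Set Implicit Arguments.
Unset Strict Implicit.
Unset Printing Implicit Defensive.
Import Order.TTheory GRing.Theory Num.Theory.

(* Let y lie in the closure of theta(C), in an evenly covered open set O and a
   chart domain of N. By definable choice there is a definable curve gamma on
   ]0, c[ with values in C over O, in one chart of M, such that theta(gamma t)
   tends to y as t -> 0. A definable function of one variable is continuous to
   the right of 0, so after shrinking c the curve is a path and stays in one
   component D of the preimage of O. As theta is a homeomorphism from D to O,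
   the point of D over y is the limit of gamma, hence lies in C since C is
   closed.

   Continuity at some point of every interval is a Baire-type argument: a
   definable function has arbitrarily small oscillation on subintervals, while
   if it were discontinuous everywhere, its oscillation, chosen definably,
   would be bounded below by a positive constant on a subinterval. *)

(** * Definable predicates *)

Section Substitution.
Context (R : rcfType) (L : language) (S : expansion R L).

Fixpoint tsubst n m (s : 'I_n -> term R L m) (t : term R L n) : term R L m :=
  match t with
  | Var i => s i
  | Par a => Par L m a
  | Zero => Zero R L m
  | One => One R L m
  | Opp t1 => Opp (tsubst s t1)
  | Add t1 t2 => Add (tsubst s t1) (tsubst s t2)
  | Mul t1 t2 => Mul (tsubst s t1) (tsubst s t2)
  | App f ts => App (fun i => tsubst s (ts i))
  end.

Lemma teval_tsubst n m (s : 'I_n -> term R L m) (t : term R L n) x :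
  teval S x (tsubst s t) = teval S (\row_i teval S x (s i)) t.
Proof.
elim: t => //=.
- by move=> i; rewrite mxE.
- by move=> t ->.
- by move=> t -> u ->.
- by move=> t -> u ->.
- by move=> f ts IH; congr finterp; apply/rowP => i; rewrite !mxE IH.
Qed.

(** Under a binder variable 0 stays fixed, and the terms of [s] are shifted past it. *)
Definition subst_up n m (s : 'I_n -> term R L m) (i : 'I_n.+1) :
    term R L m.+1 :=
  if unlift ord0 i is Some j
  then tsubst (fun k => Var R L (lift ord0 k)) (s j) else Var R L ord0.

Fixpoint fsubst n (phi : formula R L n) :
    forall m, ('I_n -> term R L m) -> formula R L m :=
  match phi in formula _ _ k
    return forall m, ('I_k -> term R L m) -> formula R L m with
  | Eq _ t u => fun m s => Eq (tsubst s t) (tsubst s u)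
  | Lt _ t u => fun m s => Lt (tsubst s t) (tsubst s u)
  | Rel _ r ts => fun m s => Rel (fun i => tsubst s (ts i))
  | Neg _ f => fun m s => Neg (fsubst f s)
  | And _ f g => fun m s => And (fsubst f s) (fsubst g s)
  | Ex _ f => fun m s => Ex (fsubst f (subst_up s))
  end.

Lemma row_mx_const0 n (a : R) (x : 'rV[R]_n) :
  (row_mx (const_mx a : 'rV[R]_1) x : 'rV[R]_n.+1) ord0 ord0 = a.
Proof.
have := row_mxEl (const_mx a : 'rV[R]_1) x ord0 ord0; rewrite [RHS]mxE.
by have -> : lshift n (ord0 : 'I_1) = ord0 by exact: ord_inj.
Qed.

Lemma row_mx_const_lift n (a : R) (x : 'rV[R]_n) i :
  (row_mx (const_mx a : 'rV[R]_1) x : 'rV[R]_n.+1) ord0 (lift ord0 i) =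
    x ord0 i.
Proof.
have := row_mxEr (const_mx a : 'rV[R]_1) x ord0 i.
by have -> : rshift 1 i = lift ord0 i by exact: ord_inj.
Qed.

Lemma row_mx_const_eta n (x : 'rV[R]_n.+1) :
  row_mx (const_mx (x ord0 ord0) : 'rV[R]_1) (\row_i x ord0 (lift ord0 i)) = x.
Proof.
apply/rowP => i; case: (unliftP ord0 i) => [j|] ->.
  by rewrite row_mx_const_lift mxE.
by rewrite row_mx_const0.
Qed.

Lemma holds_fsubst n (phi : formula R L n) m (s : 'I_n -> term R L m) x :
  holds S (fsubst phi s) x <-> holds S phi (\row_i teval S x (s i)).
Proof.
elim: phi m s x => {n} /=.
- by move=> n t u m s x; rewrite !teval_tsubst.
- by move=> n t u m s x; rewrite !teval_tsubst.
- move=> n r ts m s x.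
  suff -> : \row_i teval S x (tsubst s (ts i)) =
    \row_i teval S (\row_i0 teval S x (s i0)) (ts i) by [].
  by apply/rowP => i; rewrite !mxE teval_tsubst.
- by move=> n f IH m s x; rewrite IH.
- by move=> n f IHf g IHg m s x; rewrite IHf IHg.
- move=> n f IH m s x.
  have eqx a : \row_i teval S
      (row_mx (const_mx a : 'rV[R]_1) x : 'rV[R]_m.+1) (subst_up s i) =
      row_mx (const_mx a : 'rV[R]_1) (\row_i teval S x (s i)).
    apply/rowP => i; rewrite mxE /subst_up; case: unliftP => [j|] ->.
      rewrite row_mx_const_lift mxE teval_tsubst; congr teval.
      by apply/rowP => k; rewrite mxE /= row_mx_const_lift.
    by rewrite row_mx_const0 /= row_mx_const0.
  by split=> -[a Ha]; exists a; [rewrite -eqx -IH | rewrite IH eqx].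
Qed.

End Substitution.

(** * Closure properties of definable predicates, functions and vectors *)

Section DefinablePredicates.
Context (R : rcfType) (L : language) (S : expansion R L).
Implicit Types (P Q : (nat -> R) -> Prop) (g h : (nat -> R) -> R).

(* Environments are indexed by [nat] rather than 'I_n so that quantifiers and
   substitutions do not change types; the formula is required for all large n
   so that finitely many predicates can share one n. *)
Definition definable_pred P : Prop :=
  exists N, forall n, (N <= n)%N -> exists phi : formula R L n,
    forall e, P e <-> holds S phi (\row_(i < n) e i).

(** Definability of the graph: slot 0 carries the value and the arguments move up by one. *)
Definition definable_fun g : Prop :=
  definable_pred (fun e => g (fun i => e i.+1) = e 0%N).

Definition definable_vec k (v : (nat -> R) -> 'rV[R]_k) : Prop :=
  forall i, definable_fun (fun e => v e ord0 i).

Definition term_fun g : Prop :=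
  exists N, forall n, (N <= n)%N -> exists t : term R L n,
    forall e, g e = teval S (\row_(i < n) e i) t.

Lemma definable_pred_iff P Q :
  (forall e, P e <-> Q e) -> definable_pred P -> definable_pred Q.
Proof.
move=> PQ [N HN]; exists N => n /HN[phi Hphi]; exists phi => e.
by rewrite -PQ.
Qed.

Lemma definable_pred_not P :
  definable_pred P -> definable_pred (fun e => ~ P e).
Proof.
move=> [N HN]; exists N => n /HN[phi Hphi]; exists (Neg phi) => e /=.
by rewrite Hphi.
Qed.

Lemma definable_pred_and P Q : definable_pred P -> definable_pred Q ->
  definable_pred (fun e => P e /\ Q e).
Proof.
move=> [N HN] [N' HN']; exists (maxn N N') => n; rewrite geq_max => /andP[].
move=> /HN[phi Hphi] /HN'[psi Hpsi]; exists (And phi psi) => e /=.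
by rewrite Hphi Hpsi.
Qed.

Lemma definable_pred_or P Q : definable_pred P -> definable_pred Q ->
  definable_pred (fun e => P e \/ Q e).
Proof.
move=> DP DQ; apply: (definable_pred_iff (P := fun e => ~ (~ P e /\ ~ Q e))).
  by move=> e; rewrite not_andE !notE.
by apply/definable_pred_not/definable_pred_and; apply: definable_pred_not.
Qed.

Lemma definable_pred_imp P Q : definable_pred P -> definable_pred Q ->
  definable_pred (fun e => P e -> Q e).
Proof.
move=> DP DQ; apply: (definable_pred_iff (P := fun e => ~ P e \/ Q e)).
  by move=> e; rewrite implyE.
by apply/definable_pred_or => //; apply: definable_pred_not.
Qed.

(** Binding follows de Bruijn: the witness enters slot 0 and the old environment is shifted, as in
    [Ex]. *)
Lemma definable_pred_ex (P : R -> (nat -> R) -> Prop) :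
  definable_pred (fun e => P (e 0%N) (fun i => e i.+1)) ->
  definable_pred (fun e => exists a, P a e).
Proof.
move=> [N HN]; exists N => n Nn.
have [phi Hphi] := HN n.+1 (leqW Nn).
exists (Ex phi) => e /=.
have E a : P a e <->
    holds S phi (row_mx (const_mx a : 'rV[R]_1) (\row_(i < n) e i)).
  have := Hphi (fun i => if i is i'.+1 then e i' else a) => /= ->.
  suff -> : \row_(i < n.+1) (if i : nat is i'.+1 then e i' else a) =
    row_mx (const_mx a : 'rV[R]_1) (\row_(i < n) e i) by [].
  apply/rowP => i; rewrite mxE; case: (unliftP ord0 i) => [j|] ->.
    by rewrite row_mx_const_lift mxE /= /bump.
  by rewrite row_mx_const0.
by split=> -[a] /E; exists a.
Qed.

Lemma definable_pred_all (P : R -> (nat -> R) -> Prop) :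
  definable_pred (fun e => P (e 0%N) (fun i => e i.+1)) ->
  definable_pred (fun e => forall a, P a e).
Proof.
move=> DP; apply: (definable_pred_iff (P := fun e => ~ exists a, ~ P a e)).
  by move=> e; rewrite -forallNE; split=> H a; have := H a; rewrite ?notE.
by apply/definable_pred_not/definable_pred_ex/definable_pred_not.
Qed.

Lemma definable_pred_bool (b : Prop) : definable_pred (fun=> b).
Proof.
exists 0%N => n _; have [Hb|Hb] := pselect b.
  by exists (Eq (Zero R L n) (Zero R L n)) => e /=; split.
by exists (Neg (Eq (Zero R L n) (Zero R L n))) => e /=; split.
Qed.

Lemma term_fun_var i : term_fun (fun e => e i).
Proof.
exists i.+1 => n lin; exists (Var R L (Ordinal lin)) => e.
by rewrite /= mxE.
Qed.

Lemma term_fun_cst a : term_fun (fun=> a).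
Proof. by exists 0%N => n _; exists (Par L n a). Qed.

(** A formula at level [N] reads only [N] slots, so finitely many terms are substituted and the
    maximum of their bounds serves them all. *)
Lemma definable_pred_subst (s : nat -> (nat -> R) -> R) P :
  (forall i, term_fun (s i)) -> definable_pred P ->
  definable_pred (fun e => P (fun i => s i e)).
Proof.
move=> /(_ _)/cid-/all_sig[M HM] [N HN].
have [phi Hphi] := HN N (leqnn N).
exists (\max_(i < N) M i) => n len.
have /all_sig[u Hu] (i : 'I_N) : {t : term R L n |
    forall e, s i e = teval S (\row_(j < n) e j) t}.
  apply/cid/HM; apply: leq_trans len.
  exact: (leq_bigmax_cond (F := fun i : 'I_N => M i)).
exists (fsubst phi u) => e; rewrite Hphi holds_fsubst.
suff -> : \row_(i < N) s i e = \row_i teval S (\row_(i0 < n) e i0) (u i) by [].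
by apply/rowP => i; rewrite !mxE.
Qed.

Lemma definable_pred_ren (s : nat -> nat) P :
  definable_pred P -> definable_pred (fun e => P (fun i => e (s i))).
Proof.
apply: (definable_pred_subst (s := fun i e => e (s i))) => i.
exact: term_fun_var.
Qed.

Lemma definable_fun_ren (s : nat -> nat) g :
  definable_fun g -> definable_fun (fun e => g (fun i => e (s i))).
Proof.
exact: (definable_pred_ren (fun i => if i is j.+1 then (s j).+1 else 0%N)).
Qed.

Lemma definable_pred_eq_var i j : definable_pred (fun e => e i = e j).
Proof.
exists (maxn i j).+1 => n; rewrite gtn_max => /andP[li lj].
exists (Eq (Var R L (Ordinal li)) (Var R L (Ordinal lj))) => e.
by rewrite /= !mxE.
Qed.

Lemma definable_fun_var i : definable_fun (fun e => e i).
Proof. exact: definable_pred_eq_var. Qed.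

Lemma definable_fun_cst a : definable_fun (fun=> a).
Proof.
apply: (definable_pred_subst
  (s := fun i e => if i is 0%N then a else e 0%N) _ (definable_pred_eq_var 0 1)).
by case=> [|i]; [apply: term_fun_cst|apply: term_fun_var].
Qed.

Lemma definable_pred_eq g h : definable_fun g -> definable_fun h ->
  definable_pred (fun e => g e = h e).
Proof.
move=> Dg Dh.
apply: (definable_pred_iff (P := fun e => exists a, g e = a /\ h e = a)).
  by move=> e; split=> [[a [-> ->]]|->] //; exists (h e).
by apply/definable_pred_ex/definable_pred_and.
Qed.

(* [definable_pred_subst] only allows terms; composition with definable functions
   goes through quantification over their values. *)
Lemma definable_pred_app2 (P : R -> R -> Prop) g h :
  definable_pred (fun e => P (e 0%N) (e 1%N)) ->
  definable_fun g -> definable_fun h ->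
  definable_pred (fun e => P (g e) (h e)).
Proof.
move=> DP Dg Dh; apply: (definable_pred_iff
    (P := fun e => exists b, h e = b /\ exists a, g e = a /\ P a b)).
  move=> e; split=> [[a [-> [b [-> ]]]]|?] //; exists (h e); split=> //.
  by exists (g e).
apply/definable_pred_ex/definable_pred_and => //.
apply/definable_pred_ex/definable_pred_and => //.
apply: (definable_pred_eq (g := fun e => g (fun i => e i.+2))).
  exact: (definable_fun_ren (fun i => i.+2)).
exact: definable_fun_var.
Qed.

Lemma definable_fun_app1 (f : R -> R) g :
  definable_fun (fun e => f (e 0%N)) -> definable_fun g ->
  definable_fun (fun e => f (g e)).
Proof.
move=> Df Dg; apply: (definable_pred_app2 (P := fun a b => f a = b)
   (g := fun e => g (fun i => e i.+1)) (h := fun e => e 0%N)).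
- by apply: (definable_pred_eq Df); apply: definable_fun_var.
- exact: (definable_fun_ren (fun i => i.+1)).
- exact: definable_fun_var.
Qed.

Lemma definable_fun_app2 (f : R -> R -> R) g h :
  definable_fun (fun e => f (e 0%N) (e 1%N)) ->
  definable_fun g -> definable_fun h ->
  definable_fun (fun e => f (g e) (h e)).
Proof.
move=> Df Dg Dh; apply: (definable_pred_iff (P := fun e => exists a,
    g (fun i => e i.+1) = a /\ f a (h (fun i => e i.+1)) = e 0%N)).
  by move=> e; split=> [[a [<- ]]|?] //; exists (g (fun i => e i.+1)).
apply/definable_pred_ex/definable_pred_and => /=.
  apply: (definable_pred_eq (g := fun e => g (fun i => e i.+2))).
    exact: (definable_fun_ren (fun i => i.+2)).
  exact: definable_fun_var.
apply: (definable_pred_iff (P := fun e => exists b,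
    h (fun i => e i.+2) = b /\ f (e 0%N) b = e 1%N)).
  by move=> e; split=> [[a [<- ]]|?] //; exists (h (fun i => e i.+2)).
apply/definable_pred_ex/definable_pred_and => /=.
  apply: (definable_pred_eq (g := fun e => h (fun i => e i.+3))).
    exact: (definable_fun_ren (fun i => i.+3)).
  exact: definable_fun_var.
(* Slots 0, 1, 2 now hold [b], [a] and the value, while [Df] expects the value, [a], [b]. *)
exact: (definable_pred_ren
  (fun i => if i is j.+1 then (if j is k.+1 then k else 1)%N else 2%N) Df).
Qed.

Lemma definable_fun_add g h : definable_fun g -> definable_fun h ->
  definable_fun (fun e => g e + h e).
Proof.
apply: (definable_fun_app2 (f := fun a b => a + b)).
exists 3%N => n l3n; exists (Eq
  (Add (Var R L (Ordinal (ltnW l3n))) (Var R L (Ordinal l3n)))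
  (Var R L (Ordinal (ltnW (ltnW l3n))))) => e.
by rewrite /= !mxE.
Qed.

Lemma definable_fun_mul g h : definable_fun g -> definable_fun h ->
  definable_fun (fun e => g e * h e).
Proof.
apply: (definable_fun_app2 (f := fun a b => a * b)).
exists 3%N => n l3n; exists (Eq
  (Mul (Var R L (Ordinal (ltnW l3n))) (Var R L (Ordinal l3n)))
  (Var R L (Ordinal (ltnW (ltnW l3n))))) => e.
by rewrite /= !mxE.
Qed.

Lemma definable_fun_opp g : definable_fun g -> definable_fun (fun e => - g e).
Proof.
apply: (definable_fun_app1 (f := fun a => - a)).
exists 2%N => n l2n; exists (Eq (Opp (Var R L (Ordinal l2n)))
  (Var R L (Ordinal (ltnW l2n)))) => e.
by rewrite /= !mxE.
Qed.

Lemma definable_pred_lt g h : definable_fun g -> definable_fun h ->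
  definable_pred (fun e => g e < h e).
Proof.
apply: (definable_pred_app2 (P := fun a b => a < b)).
exists 2%N => n l2n; exists (Lt (Var R L (Ordinal (ltnW l2n)))
  (Var R L (Ordinal l2n))) => e.
by rewrite /= !mxE.
Qed.

Lemma definable_pred_le g h : definable_fun g -> definable_fun h ->
  definable_pred (fun e => g e <= h e).
Proof.
move=> Dg Dh; apply: (definable_pred_iff (P := fun e => ~ h e < g e)).
  by move=> e; rewrite leNgt; split=> /negP.
exact/definable_pred_not/definable_pred_lt.
Qed.

(** Coordinates are quantified one at a time; the first one is bound innermost, so that it lands in
    slot 0. *)
Lemma definable_pred_exV k (P : 'rV[R]_k -> (nat -> R) -> Prop) :
  definable_pred (fun e => P (\row_(i < k) e i) (fun i => e (k + i)%N)) ->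
  definable_pred (fun e => exists v, P v e).
Proof.
elim: k P => [|k IH] P DP.
  apply: definable_pred_iff DP => e; split; first by exists (\row_i e i).
  by move=> [v]; rewrite (_ : v = \row_(i < 0) e i)//; apply/rowP => -[].
apply: (definable_pred_iff (P := fun e => exists v : 'rV_k, exists a,
    P (row_mx (const_mx a : 'rV_1) v) e)).
  move=> e; split=> [[v [a Pav]]|[v Pv]]; first by eexists; exact: Pav.
  exists (\row_i v ord0 (lift ord0 i)), (v ord0 ord0).
  by rewrite row_mx_const_eta.
apply/IH/definable_pred_ex; apply: definable_pred_iff DP => e.
suff -> : row_mx (const_mx (e 0) : 'rV_1) (\row_(i < k) e i.+1) =
  \row_(i < k.+1) e i by [].
apply/rowP => i; rewrite [RHS]mxE; case: (unliftP ord0 i) => [j|] ->.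
  by rewrite row_mx_const_lift mxE.
by rewrite row_mx_const0.
Qed.

Lemma definable_pred_allI (I : finType) (P : I -> (nat -> R) -> Prop) :
  (forall i, definable_pred (P i)) -> definable_pred (fun e => forall i, P i e).
Proof.
move=> DP; apply: (definable_pred_iff
    (P := fun e => forall i, i \in enum I -> P i e)).
  by move=> e; split=> H i; [apply: H; rewrite mem_enum|move=> _].
elim: (enum I) => [|j s IH].
  by apply: definable_pred_iff (definable_pred_bool True) => e.
apply: definable_pred_iff (definable_pred_and (DP j) IH) => e; split.
  by move=> [Pj Ps] i; rewrite in_cons => /orP[/eqP->|/Ps].
by move=> H; split=> [|i si]; apply: H; rewrite in_cons ?eqxx ?si ?orbT.
Qed.

Lemma definable_pred_exS (I : Type) (A : set I) (P : I -> (nat -> R) -> Prop) :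
  finite_set A -> (forall i, A i -> definable_pred (P i)) ->
  definable_pred (fun e => exists2 i, A i & P i e).
Proof.
(* A classical choice structure on the index type allows the finite set to be listed. *)
elim/Pchoice: I => I in A P *.
move=> /finite_seqP[s ->] DP.
have {}DP i : i \in s -> definable_pred (P i) by move=> si; apply: DP.
elim: s DP => [|j s IH] DP.
  by apply: definable_pred_iff (definable_pred_bool False) => e; split=> // -[].
have {}IH : definable_pred (fun e => exists2 i, [set` s] i & P i e).
  by apply: IH => i si; apply: DP; rewrite in_cons si orbT.
have DPj : definable_pred (P j) by apply: DP; rewrite in_cons eqxx.
apply: definable_pred_iff (definable_pred_or DPj IH) => e; split.
  move=> [Pj|[i si Pi]]; first by exists j => //=; rewrite in_cons eqxx.
  by exists i => //=; rewrite in_cons; apply/orP; right.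
move=> [i /=]; rewrite in_cons => /orP[/eqP->|si Pi]; first by left.
by right; exists i.
Qed.

Lemma definable_pred_eqV k (v w : (nat -> R) -> 'rV[R]_k) :
  definable_vec v -> definable_vec w -> definable_pred (fun e => v e = w e).
Proof.
move=> Dv Dw; apply: (definable_pred_iff
    (P := fun e => forall i, v e ord0 i = w e ord0 i)).
  by move=> e; split=> [/rowP|->].
by apply: definable_pred_allI => i; apply: definable_pred_eq.
Qed.

Lemma definable_vec_row k (g : 'I_k -> (nat -> R) -> R) :
  (forall i, definable_fun (g i)) -> definable_vec (fun e => \row_i g i e).
Proof.
move=> Dg i; rewrite (_ : (fun _ => _) = g i)//.
by apply/funext => e; rewrite mxE.
Qed.

Lemma definable_vec_ren k (s : nat -> nat) (v : (nat -> R) -> 'rV[R]_k) :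
  definable_vec v -> definable_vec (fun e => v (fun i => e (s i))).
Proof. by move=> Dv i; exact: (definable_fun_ren s (Dv i)). Qed.

Lemma definable_vec_var k m : definable_vec (fun e => \row_(i < k) e (m + i)%N).
Proof. by apply: definable_vec_row => i; apply: definable_fun_var. Qed.

Lemma definable_vec_cst k (v : 'rV[R]_k) : definable_vec (fun=> v).
Proof. by move=> i; apply: definable_fun_cst. Qed.

Lemma definable_vec_cat k m (v : (nat -> R) -> 'rV[R]_k)
    (w : (nat -> R) -> 'rV[R]_m) :
  definable_vec v -> definable_vec w ->
  definable_vec (fun e => row_mx (v e) (w e)).
Proof.
move=> Dv Dw i; case: (splitP i) => j ij.
  have -> : i = lshift m j by exact: ord_inj.
  apply: definable_pred_iff (Dv j) => e; by rewrite row_mxEl.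
have -> : i = rshift k j by exact: ord_inj.
apply: definable_pred_iff (Dw j) => e; by rewrite row_mxEr.
Qed.

Lemma definable_vec_const1 g :
  definable_fun g -> definable_vec (fun e => const_mx (g e) : 'rV[R]_1).
Proof.
by move=> Dg i; apply: definable_pred_iff Dg => e; rewrite mxE.
Qed.

(** As [v] need not be given by terms, its value is first named by an existential quantifier. *)
Lemma definable_pred_mem k (X : set 'rV[R]_k) (v : (nat -> R) -> 'rV[R]_k) :
  definable S X -> definable_vec v -> definable_pred (fun e => X (v e)).
Proof.
move=> [phi ->] Dv; apply: (definable_pred_iff
    (P := fun e => exists w, v e = w /\ holds S phi w)).
  by move=> e; split=> [[w [<-]]|?] //; exists (v e).
apply: definable_pred_exV; apply: definable_pred_and.
  apply: (definable_pred_eqV (v := fun e => v (fun i => e (k + i)%N))).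
    exact: definable_vec_ren.
  exact: (definable_vec_var 0).
exists k => n lkn; exists (fsubst phi (fun i => Var R L (widen_ord lkn i))) => e.
rewrite holds_fsubst; suff -> : \row_i teval S (\row_(i0 < n) e i0)
  (Var R L (widen_ord lkn i)) = \row_(i < k) e i by [].
by apply/rowP => i; rewrite !mxE /= mxE.
Qed.

Lemma definable_predP k (X : set 'rV[R]_k) :
  definable_pred (fun e => X (\row_(i < k) e i)) <-> definable S X.
Proof.
split=> [[N HN]|DX]; last first.
  exact: (definable_pred_mem DX (definable_vec_var 0)).
have [phi Hphi] := HN N (leqnn N).
(* Only the first [k] slots matter; variables of larger index are replaced by 0. *)
exists (fsubst phi (fun i : 'I_N =>
  if insub (i : nat) is Some j then Var R L (j : 'I_k) else Zero R L k)).
apply/seteqP.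
suff E x : X x <-> holds S (fsubst phi (fun i : 'I_N =>
    if insub (i : nat) is Some j then Var R L (j : 'I_k) else Zero R L k)) x.
  by split=> x /E.
rewrite holds_fsubst.
pose e (i : nat) := if insub i is Some j then x ord0 (j : 'I_k) else 0.
have -> : \row_(i < N) teval S x (if insub (i : nat) is Some j
    then Var R L (j : 'I_k) else Zero R L k) = \row_(i < N) e i.
  by apply/rowP => i; rewrite !mxE /e; case: insub.
rewrite -Hphi; suff -> : \row_(i < k) e i = x by [].
by apply/rowP => i; rewrite mxE /e valK.
Qed.

Lemma definable_pred1P (X : set R) : definable_pred (fun e => X (e 0%N)) <->
  definable S [set v : 'rV[R]_1 | X (v ord0 ord0)].
Proof.
rewrite -definable_predP; split; apply: definable_pred_iff => e /=;
by rewrite mxE.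
Qed.

(** By uniqueness the graph is [P] itself, completed by the default value 0 where there is no
    solution. *)
Lemma definable_fun_xget (P : (nat -> R) -> R -> Prop) :
  definable_pred (fun e => P (fun i => e i.+1) (e 0%N)) ->
  (forall e a b, P e a -> P e b -> a = b) ->
  definable_fun (fun e => xget 0 (P e)).
Proof.
move=> DP unP; apply: (definable_pred_iff (P := fun e =>
    P (fun i => e i.+1) (e 0%N) \/
    (forall a, ~ P (fun i => e i.+1) a) /\ e 0%N = 0)).
  move=> e; case: xgetP => [a ea Pa|nP].
    split=> [[Pe|[/(_ a)//]]|<-]; first exact: (unP _ _ _ Pa Pe).
    by left.
  by split=> [[/nP//|[]//]|<-]; right.
apply: definable_pred_or => //; apply: definable_pred_and.
  apply/definable_pred_all/definable_pred_not.
  exact: (definable_pred_ren (fun i => if i is j.+1 then j.+2 else 0)%N DP).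
by apply: definable_pred_eq; [apply: definable_fun_var|apply: definable_fun_cst].
Qed.

Lemma definable_fun_if P g h :
  definable_pred P -> definable_fun g -> definable_fun h ->
  definable_fun (fun e => if `[< P e >] then g e else h e).
Proof.
move=> DP Dg Dh; apply: (definable_pred_iff (P := fun e =>
    (P (fun i => e i.+1) /\ g (fun i => e i.+1) = e 0%N) \/
    (~ P (fun i => e i.+1) /\ h (fun i => e i.+1) = e 0%N))).
  move=> e; case: asboolP; tauto.
have DP' := definable_pred_ren (fun i => i.+1) DP.
apply: definable_pred_or; apply: definable_pred_and => //.
exact: definable_pred_not.
Qed.

End DefinablePredicates.

(** * Consequences of o-minimality and definable choice *)

(** This tactic and the next two follow the syntax of the goal and leave the atoms they do not
    recognise, such as membership in a definable set. *)
Ltac prove_definable_fun :=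
  cbv beta;
  lazymatch goal with
  | |- definable_fun _ (fun e => e ?i) => exact: (definable_fun_var _ i)
  | |- definable_fun _ (fun _ => ?c) => exact: (definable_fun_cst _ c)
  | |- definable_fun _ (fun e => _ + _) =>
      apply: definable_fun_add; prove_definable_fun
  | |- definable_fun _ (fun e => _ * _) =>
      apply: definable_fun_mul; prove_definable_fun
  | |- definable_fun _ (fun e => - _) =>
      apply: definable_fun_opp; prove_definable_fun
  | |- definable_fun _ (fun e => fun_of_matrix (\row_i _) _ _) =>
      apply: definable_vec_row => ?; prove_definable_fun
  | H : definable_fun _ (fun e => ?f (e 0%N))
    |- definable_fun _ (fun e => ?f _) =>
      apply: (definable_fun_app1 H); prove_definable_fun
  | _ => idtac
  end.

Ltac prove_definable_vec :=
  cbv beta;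
  lazymatch goal with
  | |- definable_vec _ (fun _ => ?c) => exact: (definable_vec_cst _ c)
  | |- definable_vec _ (fun e => \row_i _) =>
      apply: definable_vec_row => ?; prove_definable_fun
  | |- definable_vec _ (fun e => row_mx _ _) =>
      apply: definable_vec_cat; prove_definable_vec
  | |- definable_vec _ (fun e => const_mx _) =>
      apply: definable_vec_const1; prove_definable_fun
  | _ => idtac
  end.

Ltac prove_definable :=
  cbv beta delta [mkset];
  lazymatch goal with
  | |- definable_pred _ (fun _ => ?c) => exact: (definable_pred_bool _ c)
  | |- definable_pred _ (fun e => _ /\ _) =>
      apply: definable_pred_and; prove_definable
  | |- definable_pred _ (fun e => _ \/ _) =>
      apply: definable_pred_or; prove_definable
  | |- definable_pred _ (fun e => ~ _) =>
      apply: definable_pred_not; prove_definable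
  | |- definable_pred _ (fun e => exists _ : 'rV__, _) =>
      apply: definable_pred_exV; prove_definable
  | |- definable_pred _ (fun e => exists _, _) =>
      apply: definable_pred_ex; prove_definable
  | |- definable_pred _ (fun e => forall _ : _, _) =>
      first [apply: definable_pred_all | apply: definable_pred_allI => ?
            |apply: definable_pred_imp]; prove_definable
  | |- definable_pred _ (fun e => is_true (_ < _)) =>
      apply: definable_pred_lt; prove_definable_fun
  | |- definable_pred _ (fun e => is_true (_ <= _)) =>
      apply: definable_pred_le; prove_definable_fun
  | |- definable_pred _ (fun e => _ = _) =>
      first [apply: definable_pred_eq; prove_definable_fun
            |apply: definable_pred_eqV; prove_definable_vec]
  | |- _ => idtac
  end.

Section OMinimality.
Context (R : rcfType) (L : language) (S : expansion R L).
Implicit Types (X : set R) (I : interval R).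

(** The infimum in first-order form, so that it depends definably on parameters. Its existence is a
    matter of o-minimality, since [R] need not be complete. *)
Definition is_glb X (a : R) : Prop :=
  (forall x, X x -> a <= x) /\ (forall c, a < c -> exists x, X x /\ x < c).

Lemma is_glb_unique X a b : is_glb X a -> is_glb X b -> a = b.
Proof.
move=> [la ga] [lb gb]; apply/eqP; rewrite eq_le.
by apply/andP; split; rewrite leNgt; apply/negP;
  [move/gb => [x [/la]]|move/ga => [x [/lb]]]; rewrite leNgt => /negP.
Qed.

Lemma interval_mid I x y z : x \in I -> y \in I -> x < z -> z < y -> z \in I.
Proof.
move=> xI yI xz zy; apply: (@interval_is_interval _ I x y) => //.
by rewrite !ltW.
Qed.

(** If the interval meets every right neighbourhood of [a], convexity makes it contain everything
    between [a] and one of its points. *)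
Lemma interval_germ I (a : R) : exists2 c, a < c &
  (forall x, a < x -> x < c -> x \in I) \/
  (forall x, a < x -> x < c -> x \notin I).
Proof.
have [[c [ac cI]]|nI] := pselect (exists c, a < c /\
    forall x, a < x -> x < c -> x \notin I); first by exists c => //; right.
have pI c : a < c -> exists x, [/\ a < x, x < c & x \in I].
  move=> ac; apply: contrapT => n; apply: nI; exists c; split => // x ax xc.
  by apply/negP => xI; apply: n; exists x.
have [c [ac _ cI]] := pI (a + 1) (ltr_pwDr ltr01 (lexx a)).
exists c => //; left => x ax xc; have [d [ad dx dI]] := pI x ax.
exact: interval_mid dI cI dx xc.
Qed.

Lemma interval_glb I x0 B : x0 \in I -> (forall x, x \in I -> B <= x) ->
  exists a, is_glb [set` I] a.
Proof.
case: I => l r x0I BI.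
have := x0I; rewrite itv_boundlr => /andP[lx0 x0r].
have below y : (l <= BLeft y)%O -> y <= x0 -> y \in Interval l r.
  move=> ly yx0; rewrite itv_boundlr ly /=.
  by apply: le_trans x0r; rewrite bnd_simp.
case: l x0I BI lx0 below => [b u|[]] x0I BI lx0 below; last by [].
- exists u; split=> [x|c uc] /=.
    rewrite in_itv/= => /andP[+ _]; case: b {BI x0I lx0 below} => //=; exact: ltW.
  have [x0c|cx0] := ltP x0 c; first by exists x0.
  have [um mc] := (midf_lt uc).
  exists ((u + c) / 2); split => //; apply: below.
    by case: b {BI x0I lx0}; rewrite bnd_simp// ltW.
  by rewrite (le_trans (ltW mc)).
(* An interval unbounded to the left would contain [Num.min B x0 - 1], which lies below the bound
   [B]. *)
- suff : B <= Num.min B x0 - 1.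
    by rewrite leNgt ltrBlDr ltr_pwDr// ge_min lexx.
  apply: BI; apply: below => //.
  by rewrite lerBlDr ler_wpDr// ge_min lexx orbT.
Qed.

Hypothesis S_omin : o_minimal S.

Lemma o_minimal_intervals X : definable_pred S (fun e => X (e 0%N)) ->
  exists s : seq (interval R), forall t, X t <-> has (fun I => t \in I) s.
Proof.
move=> /definable_pred1P/S_omin[s /seteqP[XI IX]]; exists s => t.
split; last by move/IX; rewrite /= mxE.
by move=> Xt; apply: XI; rewrite /= mxE.
Qed.

(** Each of the finitely many intervals making up [X] has constant membership just to the right of
    [a]; the smallest of the radii works for their union. *)
Lemma definable_germ X (a : R) : definable_pred S (fun e => X (e 0%N)) ->
  exists2 c, a < c & (forall x, a < x -> x < c -> X x) \/
                     (forall x, a < x -> x < c -> ~ X x).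
Proof.
move=> /o_minimal_intervals[s Xs].
suff [c ac H] : exists2 c, a < c &
    (forall x, a < x -> x < c -> has (fun I => x \in I) s) \/
    (forall x, a < x -> x < c -> ~~ has (fun I => x \in I) s).
  exists c => //; case: H => H; [left|right] => x ax xc.
    exact/Xs/H.
  by move/Xs; exact/negP/H.
elim: s {X Xs} => [|I s [c ac IH]] /=.
  by exists (a + 1); [rewrite ltr_pwDr|right].
have [d ad dI] := interval_germ I a.
exists (Num.min c d); first by rewrite lt_min ac.
case: dI => dI.
  left=> x ax; rewrite lt_min => /andP[_ xd]; by rewrite dI.
case: IH => IH; [left|right] => x ax; rewrite lt_min => /andP[xc xd].
  by rewrite IH ?orbT.
by rewrite negb_or dI ?IH.
Qed.

(** One of the finitely many intervals is infinite, and two distinct points of it bound an open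
    interval inside [X]. *)
Lemma infinite_definable_interval X : definable_pred S (fun e => X (e 0%N)) ->
  infinite_set X -> exists a b, a < b /\ forall x, a < x -> x < b -> X x.
Proof.
move=> /o_minimal_intervals[s Xs] infX.
have [I sI infI] : exists2 I, I \in s & infinite_set [set` I].
  apply: contrapT => nI; apply: infX.
  rewrite (_ : X = \bigcup_(I in [set` s]) [set` I]).
    apply: bigcup_finite => // I sI; apply: contrapT => infI.
    by apply: nI; exists I.
  apply/seteqP; split=> x.
    by move=> /Xs/hasP[I sI xI]; exists I.
  by move=> [I sI xI]; apply/Xs/hasP; exists I.
have sub x y : x \in I -> y \in I -> x < y ->
    exists a b, a < b /\ forall x, a < x -> x < b -> X x.
  move=> xI yI xy; exists x, y; split=> // z xz zy; apply/Xs/hasP; exists I => //.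
  exact: interval_mid xI yI xz zy.
have [x xI] : exists x, x \in I.
  apply: contrapT => n; apply: infI; rewrite (_ : [set` I] = set0)//.
  by apply/seteqP; split=> x // xI; apply: n; exists x.
have [y [yI yx]] : exists y, y \in I /\ y != x.
  apply: contrapT => n; apply: infI; apply: (@sub_finite_set _ _ [set x]) => // y yI.
  by apply/eqP; apply: contrapT => /negP yx; apply: n; exists y.
by case/lt_total/orP: yx => [|] ; apply: sub.
Qed.

(** The infimum of a finite union is the minimum of the infima of its nonempty intervals. *)
Lemma definable_glb X x0 B : definable_pred S (fun e => X (e 0%N)) ->
  X x0 -> (forall x, X x -> B <= x) -> exists a, is_glb X a.
Proof.
move=> /o_minimal_intervals[s Xs] /Xs Xx0 BX.
have {}BX x : has (fun I => x \in I) s -> B <= x by move/Xs/BX.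
suff [a [la ga]] : exists a, is_glb [set x | has (fun I => x \in I) s] a.
  exists a; split=> [x /Xs/la//|c /ga[x [sx xc]]].
  by exists x; split=> //; apply/Xs.
elim: s x0 {X Xs} Xx0 BX => [//|I s IH] x0 /= Xx0 BX.
have [[x xI]|nI] := pselect (exists x, x \in I).
  have [|a [la ga]] := interval_glb (B := B) xI.
    by move=> y yI; apply: BX; rewrite yI.
  have [[y ys]|ns] := pselect (exists y, has (fun I => y \in I) s).
    have [|b [lb gb]] := IH y ys.
      by move=> z zs; apply: BX; rewrite zs orbT.
    exists (Num.min a b); split=> [z /orP[/la|/lb]|c].
    - by rewrite ge_min => ->.
    - by rewrite ge_min orbC => ->.
    rewrite gt_min => /orP[/ga|/gb] [z [zI zc]]; exists z => /=.
      by split=> //; apply/orP; left.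
    by split=> //; apply/orP; right.
  exists a; split=> [z /orP[/la//|zs]|c /ga[z [zI zc]]].
    by case: ns; exists z.
  by exists z; split => //; apply/orP; left.
have [||b [lb gb]] := IH x0.
- by case/orP: Xx0 => // x0I; case: nI; exists x0.
- by move=> z zs; apply: BX; rewrite zs orbT.
exists b; split=> [z /orP[zI|/lb//]|c /gb[z [zI zc]]].
  by case: nI; exists z.
by exists z; split => //; apply/orP; right.
Qed.

Lemma definable_fun_glb (P : (nat -> R) -> set R) :
  definable_pred S (fun e => P (fun i => e i.+1) (e 0%N)) ->
  definable_fun S (fun e => xget 0 (is_glb (P e))).
Proof.
move=> DP; apply: definable_fun_xget; last by move=> e; apply: is_glb_unique.
rewrite /is_glb; prove_definable.
- exact: (definable_pred_ren (fun i => if i is j.+1 then j.+2 else 0)%N DP).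
- exact: (definable_pred_ren (fun i => if i is j.+1 then j.+3 else 0)%N DP).
Qed.

Lemma definable_pred_app (P : (nat -> R) -> set R) u :
  definable_pred S (fun e => P (fun i => e i.+1) (e 0%N)) ->
  definable_fun S u -> definable_pred S (fun e => P e (u e)).
Proof.
move=> DP Du; apply: (definable_pred_iff
    (P := fun e => exists a, u e = a /\ P e a)).
  by move=> e; split=> [[a [-> ]]|?] //; exists (u e).
by apply/definable_pred_ex/definable_pred_and.
Qed.

(** Parameters are allowed in formulas, so all variables but one can be frozen to constants. *)
Lemma definable_section (P : (nat -> R) -> set R) e :
  definable_pred S (fun e => P (fun i => e i.+1) (e 0%N)) ->
  definable_pred S (fun e' => P e (e' 0%N)).
Proof.
apply: (definable_pred_subst (s := fun i e' => if i is j.+1 then e j else e' 0%N)).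
by case=> [|j]; [exact: term_fun_var|exact: term_fun_cst].
Qed.

(* Choose an element of least absolute value if there is one; otherwise the
   midpoint of the first interval of absolute values, cut off at length 2. *)
Lemma definable_choice (P : (nat -> R) -> set R) :
  definable_pred S (fun e => P (fun i => e i.+1) (e 0%N)) ->
  exists2 u, definable_fun S u & forall e a, P e a -> P e (u e).
Proof.
(* [Q e] collects the absolute values of elements of [P e]. It is bounded below by 0, hence has an
   infimum when nonempty. *)
move=> DP; pose Q e (u : R) := 0 <= u /\ (P e u \/ P e (- u)).
have DQ : definable_pred S (fun e => Q (fun i => e i.+1) (e 0%N)).
  rewrite /Q; prove_definable => //.
  apply: (definable_pred_app (P := fun e => P (fun i => e i.+1))).
    exact: (definable_pred_ren (fun i => if i is j.+1 then j.+2 else 0)%N DP).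
  by prove_definable_fun.
pose a e : R := xget 0 (is_glb (Q e)).
have Da : definable_fun S a by exact: definable_fun_glb.
(* The infimum of [Y e] is the right end of the first interval of [Q e]; the cut-off [a e + 2] keeps
   [Y e] nonempty when this interval is a ray. *)
pose Y e (c : R) := a e < c /\ (~ Q e c \/ c = a e + 2).
have DY : definable_pred S (fun e => Y (fun i => e i.+1) (e 0%N)).
  have Da' := definable_fun_ren (fun i => i.+1) Da.
  by rewrite /Y; prove_definable.
pose b e : R := xget 0 (is_glb (Y e)).
have Db : definable_fun S b by exact: definable_fun_glb.
pose u e := if `[< Q e (a e) >] then a e else (a e + b e) / 2.
have Du : definable_fun S u.
  apply: definable_fun_if => //; first exact: definable_pred_app.
  by prove_definable_fun.
exists (fun e => if `[< P e (u e) >] then u e else - u e).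
  apply: definable_fun_if => //; first exact: definable_pred_app.
  exact: definable_fun_opp.
move=> e x Px.
suff : Q e (u e) by case=> _ []; case: asboolP.
have Qx : Q e `|x|.
  split=> //; case: (ger0P x) => _; first by left.
  by right; rewrite opprK.
have [la ga] : is_glb (Q e) (a e).
  rewrite /a; case: xgetP => // /(_ _)nglb.
  have [|y /nglb//] := definable_glb (B := 0) (definable_section e DQ) Qx.
  by move=> ? [].
rewrite /u; case: asboolP => // nQa.
(* If [a e] is not in [Q e], elements of [Q e] come arbitrarily close to it from the right, so the
   germ of [Q e] there is full. *)
have [c ac [Qc|nQc]] := definable_germ (a e) (definable_section e DQ); last first.
  have [y [Qy yc]] := ga c ac.
  have := la y Qy; rewrite le_eqVlt => /orP[/eqP ay|ay].
    by rewrite ay in nQa.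
  by case: (nQc y ay yc).
have Y2 : Y e (a e + 2) by split; [rewrite ltr_pwDr|right].
have [lb gb] : is_glb (Y e) (b e).
  rewrite /b; case: xgetP => // /(_ _)nglb.
  have [|y /nglb//] := definable_glb (B := a e) (definable_section e DY) Y2.
  by move=> ? [/ltW].
have ab : a e < b e.
  rewrite ltNge; apply/negP => ba.
  (* A point of [Y e] below this minimum would lie in [Q e] and differ from the cut-off. *)
  have [|y [[ay Yy] yc]] := gb (Num.min c (a e + 2)).
    by rewrite lt_min !(le_lt_trans ba)// ltr_pwDr.
  move: yc; rewrite lt_min => /andP[yc y2].
  by case: Yy => [|y2E]; [apply; exact: Qc|rewrite y2E ltxx in y2].
have [am mb] := midf_lt ab.
apply: contrapT => nQm; suff /lb : Y e ((a e + b e) / 2).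
  by rewrite leNgt mb.
by split => //; left.
Qed.

(** Choose the first coordinate among those that extend to a solution, then the remaining ones by
    induction. *)
Lemma definable_choiceV k (P : (nat -> R) -> set 'rV[R]_k) :
  definable_pred S (fun e => P (fun i => e (k + i)%N) (\row_(i < k) e i)) ->
  exists2 u, definable_vec S u & forall e a, P e a -> P e (u e).
Proof.
elim: k P => [|k IH] P DP.
  exists (fun=> 0); first by move=> [].
  by move=> e a; rewrite (_ : a = 0)//; apply/rowP => -[].
pose Q e a := exists v : 'rV_k, P e (row_mx (const_mx a : 'rV[R]_1) v).
have rowE (e : nat -> R) a : row_mx (const_mx a : 'rV[R]_1) (\row_(i < k) e i) =
    \row_(i < k.+1) (if i : nat is j.+1 then e j else a).
  apply/rowP => i; rewrite [RHS]mxE; case: (unliftP ord0 i) => [j|] ->.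
    by rewrite row_mx_const_lift mxE.
  by rewrite row_mx_const0.
have DQ : definable_pred S (fun e => Q (fun i => e i.+1) (e 0%N)).
  apply: definable_pred_exV.
  (* The first coordinate sits in slot [k], behind the [k] other ones; the renaming brings it to the
     front and fixes the parameters. *)
  pose s i := if i is j.+1 then (if (j < k)%N then j else j.+1) else k.
  apply: definable_pred_iff (definable_pred_ren s DP) => e.
  rewrite rowE addn0 /s /=.
  rewrite (_ : (fun i => _) = (fun i => e (k + i.+1)%N)); last first.
    by apply/funext => i; rewrite ?addSn /= ltnNge leq_addr addnS.
  rewrite (_ : \row_(i < k.+1) _ =
    \row_(i < k.+1) (if i : nat is j.+1 then e j else e k)) //.
  by apply/rowP => -[[|i] lik]; rewrite !mxE //= -ltnS lik.
have [a Da Pa] := definable_choice DQ.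
have [|v Dv Pv] := IH (fun e v => P e (row_mx (const_mx (a e) : 'rV[R]_1) v)).
  apply: (definable_pred_app (P := fun e a => P (fun i => e (k + i)%N)
    (row_mx (const_mx a : 'rV[R]_1) (\row_(i < k) e i)))).
    apply: definable_pred_iff DP => e; rewrite (rowE (fun i => e i.+1)).
    suff -> : \row_(i < k.+1) e i =
      \row_(i < k.+1) (if i : nat is j.+1 then e j.+1 else e 0%N) by [].
    by apply/rowP => -[[|i] lik]; rewrite !mxE.
  exact: (definable_fun_ren (fun i => (k + i)%N)).
exists (fun e => row_mx (const_mx (a e) : 'rV[R]_1) (v e)).
  exact: (definable_vec_cat (definable_vec_const1 Da) Dv).
move=> e w Pw; have [|w' Pw'] := Pa e (w ord0 ord0); last exact: Pv Pw'.
exists (\row_i w ord0 (lift ord0 i)).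
by rewrite row_mx_const_eta.
Qed.

End OMinimality.

(** * Generic continuity in one variable *)

Section GenericContinuity.
Context (R : rcfType) (L : language) (S : expansion R L).
Hypothesis S_omin : o_minimal S.
Implicit Types (f : R -> R).

(** Spelled out with inequalities only, so that the set of continuity points is visibly
    definable. *)
Definition continuous_pt f x : Prop := forall r, 0 < r ->
  exists d, 0 < d /\ forall y, x - d < y -> y < x + d ->
    f x - r < f y /\ f y < f x + r.

Lemma infinite_open_interval (a b : R) :
  a < b -> infinite_set [set x | a < x /\ x < b].
Proof.
move=> ab fin; apply: infinite_nat.
(* Denominators start at 2 to keep every point strictly below [b]. *)
pose g (n : nat) := a + (b - a) / n.+2%:R.
have ba0 : 0 < b - a by rewrite subr_gt0.
rewrite (_ : setT = g @^-1` [set x | a < x /\ x < b]); last first.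
  apply/seteqP; split=> // n _; split; rewrite /g.
    by rewrite ltrDl divr_gt0.
  by rewrite addrC -ltrBrDr ltr_pdivrMr// ltr_pMr// ltr1n.
apply: finite_preimage fin => n m _ _ /addrI /(mulfI (lt0r_neq0 ba0)).
by move=> /invr_inj/eqP; rewrite eqr_nat => /eqP[].
Qed.

(** A finite range forces an infinite fibre by pigeonhole; an infinite definable range contains an
    interval. *)
Lemma definable_fiber_or_range f a b :
  definable_fun S (fun e => f (e 0%N)) -> a < b ->
  (exists c, infinite_set [set x | (a < x /\ x < b) /\ f x = c]) \/
  (exists c d, c < d /\
     forall y, c < y -> y < d -> exists x, (a < x /\ x < b) /\ f x = y).
Proof.
move=> Df ab.
have [fin|inf] := pselect (finite_set (f @` [set x | a < x /\ x < b])).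
  left; apply: contrapT => nc; apply: (infinite_open_interval ab).
  rewrite (_ : [set x | a < x /\ x < b] = \bigcup_(c in
    f @` [set x | a < x /\ x < b]) [set x | (a < x /\ x < b) /\ f x = c]).
    apply: bigcup_finite => // c _; apply: contrapT => infc.
    by apply: nc; exists c.
  apply/seteqP; split=> x; last by move=> [c _ []].
  by move=> abx; exists (f x) => //; exists x.
right; have [|c [d [cd Y]]] := infinite_definable_interval S_omin _ inf.
  rewrite (_ : (fun e : nat -> R => _) =
    (fun e => exists x, (a < x /\ x < b) /\ f x = e 0%N)).
    by prove_definable.
  apply/funext => e; apply/propext; split=> [[x abx <-]|[x [abx <-]]].
    by exists x.
  by exists x.
exists c, d; split => // y cy yd; have [x abx <-] := Y y cy yd.
by exists x.
Qed.

(** It suffices that [f] exceeds some [r > 0] at infinitely many points: take half the value of an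
    infinite fibre, or the midpoint of an interval of values. *)
Lemma positive_definable_bounded_below f a b :
  definable_fun S (fun e => f (e 0%N)) -> a < b ->
  (forall x, a < x -> x < b -> 0 < f x) ->
  exists r c d, [/\ 0 < r, c < d &
    forall x, c < x -> x < d -> [/\ a < x, x < b & r < f x]].
Proof.
move=> Df ab fpos.
suff [r [r0 infr]] : exists r, 0 < r /\
    infinite_set [set x | (a < x /\ x < b) /\ r < f x].
  have [|c [d [cd H]]] := infinite_definable_interval S_omin _ infr.
    by prove_definable.
  by exists r, c, d; split => // x cx xd; have [[]] := H x cx xd.
have [[c infc]|[c [d [cd Y]]]] := definable_fiber_or_range Df ab.
  have [x0 [[ax0 x0b] fx0]] := infinite_setN0 infc.
  have c0 : 0 < c by rewrite -fx0 fpos.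
  exists (c / 2); split; first by rewrite divr_gt0.
  apply: sub_infinite_set infc => x /= [abx ->]; split=> //; lra.
have [cm md] := midf_lt cd.
exists ((c + d) / 2); split.
  by have [x [[ax xb] <-]] := Y _ cm md; apply: fpos.
move=> fin; apply: (infinite_open_interval md).
apply: sub_finite_set (finite_image f fin) => y [my yd].
have [x [abx fxy]] := Y y (lt_trans cm my) yd.
by exists x => //; split => //; rewrite fxy.
Qed.

(** Either [f] is constant on an infinite set, or the preimage of an interval of values of length at
    most [r] is infinite; both sets contain an interval. *)
Lemma definable_small_oscillation f a b r :
  definable_fun S (fun e => f (e 0%N)) -> a < b -> 0 < r ->
  exists c d m, c < d /\ forall x, c < x -> x < d ->
    [/\ a < x, x < b, m <= f x & f x < m + r].
Proof.
move=> Df ab r0.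
have [[m infm]|[c [d [cd Y]]]] := definable_fiber_or_range Df ab.
  have [|c [d [cd H]]] := infinite_definable_interval S_omin _ infm.
    by prove_definable.
  exists c, d, m; split => // x cx xd; have [[ax xb] ->] := H x cx xd.
  by split => //; lra.
pose d' := Num.min d (c + r).
have cd' : c < d' by rewrite lt_min cd; lra.
have inf : infinite_set [set x | (a < x /\ x < b) /\ (c < f x /\ f x < d')].
  move=> fin; apply: (infinite_open_interval cd').
  apply: sub_finite_set (finite_image f fin) => y [cy yd'].
  have [|x [abx fxy]] := Y y cy; first by move: yd'; rewrite lt_min => /andP[].
  by exists x => //; split => //; rewrite fxy.
have [|c1 [d1 [cd1 H]]] := infinite_definable_interval S_omin _ inf.
  by prove_definable.
exists c1, d1, c; split => // x cx xd; have [[ax xb] [cf fd]] := H x cx xd.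
by split => //; [exact: ltW|move: fd; rewrite lt_min => /andP[]].
Qed.

Lemma definable_continuity_pt f a b :
  definable_fun S (fun e => f (e 0%N)) -> a < b ->
  exists x, [/\ a < x, x < b & continuous_pt f x].
Proof.
move=> Df ab; apply: contrapT => ncont.
(* [P x r] makes [r] a witness of discontinuity at [x]; definable choice turns such witnesses into
   the function [osc]. *)
pose P x r := 0 < r /\ forall d, 0 < d ->
  exists y, (x - d < y /\ y < x + d) /\ ~ (f x - r < f y /\ f y < f x + r).
have DP : definable_pred S (fun e => P (e 1%N) (e 0%N)).
  by rewrite /P; prove_definable.
have [u Du Pu] := definable_choice S_omin
  (P := fun e => P (e 0%N)) DP.
pose osc x := u (fun=> x).
have Dosc : definable_fun S (fun e => osc (e 0%N)).
  exact: (definable_pred_ren (fun i => if i is j.+1 then 1 else 0)%N Du).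
have Posc x : a < x -> x < b -> P x (osc x).
  move=> ax xb; apply: contrapT => nP; apply: ncont; exists x; split=> // r r0.
  apply: contrapT => nd; apply: nP; apply: (Pu (fun=> x) r); split=> // d d0.
  apply: contrapT => ny; apply: nd; exists d; split=> // y yx xy.
  by apply: contrapT => nf; apply: ny; exists y.
have [|r [c [d [r0 cd H]]]] := positive_definable_bounded_below Dosc ab.
  by move=> x ax xb; have [] := Posc x ax xb.
have [c1 [d1 [m [cd1 H1]]]] := definable_small_oscillation Df cd r0.
have [cx xd] := midf_lt cd1; set x := (c1 + d1) / 2 in cx xd.
have [cx' xd' mx xm] := H1 x cx xd.
have [ax xb rx] := H x cx' xd'.
(* This radius about the midpoint stays in []c1, d1[], where [f] varies by less than [r], contrary
   to [r < osc x]. *)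
have [_ /(_ ((d1 - c1) / 2))] := Posc x ax xb.
case=> [|y [[xy yx] nf]]; first by lra.
by have [||_ _ my ym] := H1 y; move: xy yx nf; rewrite /x; lra.
Qed.

(** The continuity points form a definable set, whose germ at [a] cannot be empty because every
    interval contains such a point. *)
Lemma definable_continuous_right f a :
  definable_fun S (fun e => f (e 0%N)) ->
  exists2 c, a < c & forall x, a < x -> x < c -> continuous_pt f x.
Proof.
move=> Df; have [|c ac [H|H]] := definable_germ S_omin (X := continuous_pt f) a.
- by rewrite /continuous_pt; prove_definable.
- by exists c.
- have [x [ax xc fx]] := definable_continuity_pt Df ac.
  by case: (H x ax xc).
Qed.

End GenericContinuity.

(** * Definable subspaces of locally definable spaces *)

Section Atlases.
Context (R : rcfType) (L : language) (S : expansion R L).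

(** The part of [locally_definable] needed for computing in charts, in a form that passes to
    [prod_atlas]. *)
Definition definable_transitions (X : Type) (a : atlas R X) : Prop :=
  (forall i, {in dom a i &, injective (chart a i)}) /\
  (forall i j, definable S
     [set row_mx (chart a i x) (chart a j x) | x in dom a i `&` dom a j]).

Lemma chart_inj (X : Type) (a : atlas R X) i x y : definable_transitions a ->
  dom a i x -> dom a i y -> chart a i x = chart a i y -> x = y.
Proof. by move=> [inja _] ix iy; apply: inja; rewrite inE. Qed.

Lemma locally_definable_transitions (X : Type) (a : atlas R X) :
  locally_definable S a -> definable_transitions a.
Proof.
move=> [_ inja _ _ Dtr]; split=> // i j; have [_] := Dtr i j.
suff -> : [set row_mx z (transition a i j z) |
    z in chart a i @` (dom a i `&` dom a j)] =
  [set row_mx (chart a i x) (chart a j x) | x in dom a i `&` dom a j] by [].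
(* On the overlap injectivity leaves [xget] a single candidate. *)
have trE x : (dom a i `&` dom a j) x ->
    transition a i j (chart a i x) = chart a j x.
  move=> [ix jx]; rewrite /transition; case: xgetP => [_ _ [y [[iy jy] xy] <-]|].
    by rewrite (inja i y x) ?inE.
  by move=> /(_ (chart a j x)); case; exists x.
apply/seteqP; split=> v [z].
  by move=> [x ijx <-] <-; exists x => //; rewrite trE.
by move=> ijz <-; exists (chart a i z); rewrite ?trE//; exists z.
Qed.

(** Definability, given on finitely many charts covering [Y], is carried to an arbitrary chart along
    the transition graphs. *)
Lemma definable_subspace_chart (X : Type) (a : atlas R X) (Y : set X) :
  definable_transitions a -> definable_subspace S a Y ->
  forall j, definable S (chart a j @` (Y `&` dom a j)).
Proof.
move=> tra [J [finJ YJ DY]] j; apply/definable_predP.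
pose T i := [set row_mx (chart a i x) (chart a j x) | x in dom a i `&` dom a j].
apply: (definable_pred_iff (P := fun e => exists2 i, J i & exists z,
    (chart a i @` (Y `&` dom a i)) z /\ T i (row_mx z (\row_k e k)))); last first.
  apply: definable_pred_exS => // i Ji; prove_definable.
    apply: (definable_pred_mem (DY i Ji)); prove_definable_vec.
  apply: (definable_pred_mem (tra.2 i j)); prove_definable_vec.
move=> e; split.
  move=> [i Ji [_ [[x [Yx ix] <-] [y [iy jy] /eq_row_mx[xy <-]]]]].
  by rewrite -(chart_inj tra iy ix xy) in Yx; exists y.
move=> [x [Yx jx] <-]; have [i Ji ix] := YJ x Yx.
by exists i => //; exists (chart a i x); split; exists x.
Qed.

Lemma prod_atlas_transitions (X Y : Type) (a : atlas R X) (b : atlas R Y) :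
  definable_transitions a -> definable_transitions b ->
  definable_transitions (prod_atlas a b).
Proof.
move=> tra trb; split=> [[i j]|[i j] [i' j']].
  move=> [x y] [x' y']; rewrite !inE /= => -[/= ix jy] [/= ix' jy'].
  move=> /eq_row_mx[/(chart_inj tra ix ix') -> /(chart_inj trb jy jy') ->] //.
apply/definable_predP.
pose Ta := [set row_mx (chart a i x) (chart a i' x) | x in dom a i `&` dom a i'].
pose Tb := [set row_mx (chart b j x) (chart b j' x) | x in dom b j `&` dom b j'].
apply: (definable_pred_iff (P := fun e => exists z w z' w',
    Ta (row_mx z z') /\ Tb (row_mx w w') /\
    \row_k e k = row_mx (row_mx z w) (row_mx z' w'))); last first.
  prove_definable.
  - by apply: (definable_pred_mem (tra.2 i i')); prove_definable_vec.
  - by apply: (definable_pred_mem (trb.2 j j')); prove_definable_vec.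
move=> e; split.
  move=> [z [w [z' [w' [[x [ix ix'] /eq_row_mx[<- <-]]]]]]].
  by move=> [[y [jy jy'] /eq_row_mx[<- <-]] ->]; exists (x, y).
move=> [[x y] [[/= ix jy] [/= ix' jy']] <-].
exists (chart a i x), (chart b j y), (chart a i' x), (chart b j' y).
by split; [exists x|split => //; exists y].
Qed.

(** * Images of definable subspaces under ld-maps *)

Section LdMap.
Context (X Y : Type) (a : atlas R X) (b : atlas R Y) (f : X -> Y).
Hypotheses (tra : definable_transitions a) (trb : definable_transitions b).
Hypothesis ldf : ld_map S a b f.

Lemma ld_map_chart_graph i j : definable S
  [set row_mx (chart a i x) (chart b j (f x)) | x in dom a i `&` f @^-1` dom b j].
Proof.
have [_ Df] := ldf i.
have := definable_subspace_chart (prod_atlas_transitions tra trb) Df (i, j).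
set A := (X in definable _ X -> _); set B := (X in _ -> definable _ X).
suff -> : A = B by [].
apply/seteqP; split=> v /=.
  by move=> [_ [[x ix <-] [/= _ jfx]] <-]; exists x.
by move=> [x [ix jfx] <-]; exists (x, f x) => //; split=> //; exists x.
Qed.

Lemma definable_subspace_image C :
  definable_subspace S a C -> definable_subspace S b (f @` C).
Proof.
move=> DC; have DCi := definable_subspace_chart tra DC.
have [J [finJ CJ _]] := DC.
have /choice[K HK] i : exists K, finite_set K /\
    f @` dom a i `<=` \bigcup_(j in K) dom b j.
  by have [[K [finK fK _]] _] := ldf i; exists K.
(* Finitely many domains [dom a i] cover [C], and the image of each is covered by the finitely many
   charts in [K i]. *)
exists (\bigcup_(i in J) K i); split.
- by apply: bigcup_finite => // i _; have [] := HK i.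
- move=> _ [x Cx <-]; have [i Ji ix] := CJ x Cx.
  have [_ /(_ (f x))[|j Kj jfx]] := HK i; first by exists x.
  by exists j => //; exists i.
move=> j _; apply/definable_predP.
pose G i := [set row_mx (chart a i x) (chart b j (f x)) |
  x in dom a i `&` f @^-1` dom b j].
apply: (definable_pred_iff (P := fun e => exists2 i, J i & exists z,
    (chart a i @` (C `&` dom a i)) z /\ G i (row_mx z (\row_k e k)))); last first.
  apply: definable_pred_exS => // i Ji; prove_definable.
    by apply: (definable_pred_mem (DCi i)); prove_definable_vec.
  by apply: (definable_pred_mem (ld_map_chart_graph i j)); prove_definable_vec.
move=> e; split.
  move=> [i Ji [_ [[x [Cx ix] <-] [y [iy jy] /eq_row_mx[xy <-]]]]].
  rewrite -(chart_inj tra iy ix xy) in Cx.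
  by exists (f y) => //; split=> //; exists y.
move=> [_ [[x Cx <-] jx] <-]; have [i Ji ix] := CJ x Cx.
by exists i => //; exists (chart a i x); split; exists x.
Qed.

End LdMap.

End Atlases.

(** * Definable curves *)

Section Paths.
Context (R : rcfType) (L : language) (S : expansion R L).
Hypothesis S_omin : o_minimal S.

Lemma continuous_pt_nbhs (f : R -> R) (x r : R) : continuous_pt f x -> 0 < r ->
  \forall y \near x, ball (f x) r (f y).
Proof.
move=> fx r0; have [d [d0 H]] := fx r r0.
apply/nbhs_ballP; exists d => // y; rewrite /ball /= ltr_distlC => /andP[xy yx].
by have [fxy fyx] := H y xy yx; rewrite ltr_distlC fxy fyx.
Qed.

Lemma continuous_pt_row m (f : R -> 'rV[R]_m) (x : R) :
  (forall k, continuous_pt (fun t => f t ord0 k) x) -> {for x, continuous f}.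
Proof.
move=> fx W /nbhs_ballP[r r0 rW].
have H : \forall y \near x, forall k, ball (f x ord0 k) r (f y ord0 k).
  apply: (filter_forall (nbhs_filter x)) => k.
  exact: continuous_pt_nbhs.
by apply: filterS H => y fxy; apply: rW; split=> // i k; rewrite (ord1 i).
Qed.

Lemma definable_continuous_right_row m (f : R -> 'rV[R]_m) (a : R) :
  (forall k, definable_fun S (fun e => f (e 0%N) ord0 k)) ->
  exists2 c, a < c & forall x, a < x -> x < c -> {for x, continuous f}.
Proof.
move=> Df.
have : \forall x \near a^'+, forall k, continuous_pt (fun t => f t ord0 k) x.
  apply: (@filter_forall _ _ (fun k => continuous_pt (fun t => f t ord0 k))) => k.
  have [c ac H] := definable_continuous_right S_omin
    (f := fun t => f t ord0 k) a (Df k).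
  near=> x; apply: H; near: x; first exact: nbhs_right_gt.
  exact: nbhs_right_lt.
move=> /nbhs_ballP[e e0 H]; exists (a + e); first by rewrite ltrDl.
move=> x ax xe; apply: continuous_pt_row; apply: H => //.
rewrite /ball /= ltr_distlC xe andbT; apply: lt_trans ax; by rewrite ltrBlDr ltrDl.
Unshelve. all: by end_near. Qed.

Lemma closure_bigcup_finite (T : topologicalType) (I : Type) (A : set I)
    (F : I -> set T) :
  finite_set A -> closure (\bigcup_(i in A) F i) `<=`
    \bigcup_(i in A) closure (F i).
Proof.
elim/Pchoice: I => I in A F * => finA.
(* A finite union of closures is closed, so it equals its own closure. *)
rewrite [X in _ `<=` X](closure_id _).1; last first.
  by apply: closed_bigcup => // i _; exact: closed_closure.
by apply: closure_subset; apply: subset_bigcup => i _; exact: subset_closure.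
Qed.

(** Continuity of the inverse chart, phrased without an inverse function; it comes from openness of
    the chart onto its image. *)
Lemma chart_nbhs (M : ld_space S) i (x : M) (W : set M) :
  dom (charts M) i x -> nbhs x W ->
  exists2 r, 0 < r & forall z, dom (charts M) i z ->
    ball (chart (charts M) i x) r (chart (charts M) i z) -> W z.
Proof.
move=> ix xW; have [[_ injc _] _ openc] := ld_chart_homeo i.
pose V := W° `&` dom (charts M) i.
have oV : open (V : set (subspace (dom (charts M) i))).
  by rewrite open_subspaceIT; apply/open_subspaceW/open_interior.
have /open_subspaceP[U oU UV] := openc V (@subIsetr _ _ _) oV.
have Vx : V x by split.
have : nbhs (chart (charts M) i x) U.
  apply: open_nbhs_nbhs; split => //.
  have : (chart (charts M) i @` V `&` chart_img (charts M) i) (chart (charts M) i x).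
    by split; exists x.
  by rewrite -UV => -[].
move=> /nbhs_ballP[r r0 rU]; exists r => // z iz zr.
have : (U `&` chart_img (charts M) i) (chart (charts M) i z).
  by split; [exact: rU|exists z].
rewrite UV => -[[y [Wy iy] yz] _].
by rewrite -(injc y z)// ?inE//; exact: interior_subset.
Qed.

Lemma chart_continuous (M : ld_space S) i (x : M) :
  dom (charts M) i x -> {for x, continuous (chart (charts M) i)}.
Proof.
move=> ix; have [_ + _] := ld_chart_homeo i.
rewrite continuous_open_subspace; last exact: ld_dom_open.
by apply; rewrite inE.
Qed.

(** [gamma] inherits definability and continuity from its chart expression [f]; an affine change of
    parameter then gives a path on [[0, 1]]. *)
Lemma definable_curve_path (M : ld_space S) (Y : set M) i (gamma : R -> M)
    (f : R -> 'rV[R]_(Defs.dim (charts M) i)) (c : R) :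
  (forall k, definable_fun S (fun e => f (e 0%N) ord0 k)) ->
  (forall t : R, 0 < t -> t < c -> {for t, continuous f}) ->
  (forall t : R, 0 < t -> t < c -> [/\ Y (gamma t), dom (charts M) i (gamma t) &
    chart (charts M) i (gamma t) = f t]) ->
  forall t0 t1 : R, 0 < t0 -> t0 < c -> 0 < t1 -> t1 < c ->
    ld_path Y (gamma t0) (gamma t1).
Proof.
move=> Df cf gammaP t0 t1 t00 t0c t10 t1c.
(* A convex combination of [t0] and [t1], in either order, so it stays in []0, c[]. *)
pose l (u : R) : R := t0 + u * (t1 - t0).
have lP (u : R) : 0 <= u -> u <= 1 -> 0 < l u /\ l u < c.
  move=> u0 u1; rewrite /l.
  have v0 : 0 <= 1 - u by rewrite subr_ge0.
  have [t01|t10'] := leP t0 t1.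
    have t01' : 0 <= t1 - t0 by rewrite subr_ge0.
    by move: (mulr_ge0 u0 t01') (mulr_ge0 v0 t01'); split; lra.
  have t01' : 0 <= t0 - t1 by rewrite subr_ge0 ltW.
  by move: (mulr_ge0 u0 t01') (mulr_ge0 v0 t01'); split; lra.
have cgamma (t : R) : 0 < t -> t < c -> {for t, continuous gamma}.
  move=> t_gt0 tc W; have [_ it ft] := gammaP t t_gt0 tc.
  move=> /(chart_nbhs it)[r r0 rW].
  have : nbhs (f t) (ball (f t) r) by exact: nbhsx_ballx.
  move=> /(cf t t_gt0 tc) Hf.
  suff : \forall v \near t, W (gamma v) by [].
  near=> v.
  have [||_ iv fv] := gammaP v.
  - by near: v; exact: lt_nbhsr.
  - by near: v; exact: lt_nbhsl.
  by apply: rW => //; rewrite ft fv; near: v.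
pose g u := gamma (l u).
have gP u : `[0, 1]%classic u -> [/\ Y (g u), dom (charts M) i (g u) &
    chart (charts M) i (g u) = f (l u)].
  by rewrite /= in_itv/= => /andP[u0 u1]; have [] := lP u u0 u1; apply: gammaP.
have Dl k : definable_fun S (fun e => f (t0 + e 0%N * (t1 - t0)) ord0 k).
  apply: (definable_fun_app1 (f := fun t => f t ord0 k) (Df k)).
  by prove_definable_fun.
exists g; split; last 2 first.
- by rewrite /g /l mul0r addr0.
- by rewrite /g /l mul1r addrCA subrr addr0.
- case; split.
    (* The path remains in one chart domain, so the single index [i] suffices. *)
    exists [set i]; split; first exact: finite_set1.
      by move=> _ [u /gP[Yu iu _] <-]; exists i.
    move=> _ ->; apply/definable_predP.
    apply: (definable_pred_iff (P := fun e => exists u,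
       (0 <= u /\ u <= 1) /\ \row_k e k = f (t0 + u * (t1 - t0)))).
      move=> e; split.
        move=> [u [/andP u01 ->]]; have u01' : `[0, 1]%classic u.
          by rewrite /= in_itv.
        by have [Yu iu <-] := gP u u01'; exists (g u).
      move=> [_ [[u u01 <-] _] <-]; exists u; have [_ _ <-] := gP u u01.
      by move: u01; rewrite /= in_itv/= => /andP.
    by prove_definable => k; apply: Dl.
  exists [set (tt, i)]; split; first exact: finite_set1.
    move=> _ [u u01 <-]; exists (tt, i) => //.
    by have [] := gP u u01.
  move=> _ ->; apply/definable_predP.
  apply: (definable_pred_iff (P := fun e => exists u, (0 <= u /\ u <= 1) /\
     \row_k e k = row_mx (const_mx u : 'rV_1) (f (t0 + u * (t1 - t0))))).
    move=> e; split.
      move=> [u [/andP u01 ->]]; have u01' : `[0, 1]%classic u.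
        by rewrite /= in_itv.
      have [Yu iu <-] := gP u u01'; exists (u, g u) => //.
      by split => //; exists u.
    move=> [_ [[u u01 <-] _] <-]; exists u; have [_ _ <-] := gP u u01.
    by move: u01; rewrite /= in_itv/= => /andP.
  by prove_definable => k; apply: Dl.
- apply: continuous_in_subspaceT => u /set_mem /=; rewrite in_itv/= => /andP[u0 u1].
  have [l0 lc] := lP u u0 u1.
  apply: continuous_comp; last exact: cgamma.
  by apply: cvgD; [exact: cvg_cst|apply: cvgMl].
Unshelve. all: by end_near. Qed.

End Paths.

(** * Closedness of the image under an ld-covering map *)

Theorem proposition2p12 (R : rcfType) (L : language) (S : expansion R L)
  (S_omin : o_minimal S)
  (K : Type) (K_infinite : infinite_set [set: K]) (S_saturated : saturated S K)
  (M N : ld_space S) (C : set M)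
  (C_definable : definable_subspace S (charts M) C) (C_closed : closed C)
  (theta : M -> N) (theta_covering : ld_covering theta) :
  definable_subspace S (charts N) (theta @` C) /\ closed (theta @` C).
Proof.
have trM := locally_definable_transitions (ld_charts M).
have trN := locally_definable_transitions (ld_charts N).
have [_ _ ld_theta [I [U [U_def U_cover _ U_homeo]]]] := theta_covering.
split; first exact: (definable_subspace_image trM trN ld_theta).
move=> y; have [J [finJ CJ _]] := C_definable.
(* Cutting [C] into finitely many pieces, each in one chart, puts [y] in the closure of the image of
   a single piece. *)
have CE : theta @` C =
    \bigcup_(i in J) (theta @` (C `&` dom (charts M) i)).
  apply/seteqP; split=> [_ [x Cx <-]|_ [i _ [x [Cx _] <-]]]; last by exists x.
  by have [i Ji ix] := CJ x Cx; exists i => //; exists x.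
rewrite {1}CE => /(closure_bigcup_finite finJ)[i Ji cl_y].
have [l _ Uly] : (\bigcup_l U l) y by rewrite -U_cover.
have [open_Ul def_Ul] := U_def l.
have [j _ jy] : (\bigcup_j dom (charts N) j) y.
  by have [<- _ _ _ _] := ld_charts N.
pose phi := chart (charts M) i; pose psi := chart (charts N) j.
(* Boxes of radius [t] around [y] in the chart [psi], cut down to [U l]. *)
pose near_y (t : R) (z : N) := [/\ dom (charts N) j z, U l z &
  forall k, psi y ord0 k - t < psi z ord0 k /\
            psi z ord0 k < psi y ord0 k + t].
have near_yP t : 0 < t ->
    exists x, [/\ C x, dom (charts M) i x & near_y t (theta x)].
  move=> t0; suff /cl_y[_ [[x [Cx ix] <-] yx]] : nbhs y (near_y t) by exists x.
  have yj : nbhs y (dom (charts N) j).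
    by apply: open_nbhs_nbhs; split => //; exact: ld_dom_open.
  have yl : nbhs y (U l) by apply: open_nbhs_nbhs; split.
  have /(chart_continuous jy) yt : nbhs (psi y) (ball (psi y) t).
    exact: nbhsx_ballx.
  near=> z; split; [by near: z..|move=> k].
  have : ball (psi y) t (psi z) by near: z.
  by move=> [_ /(_ ord0 k)]; rewrite /ball /= ltr_distlC => /andP.
pose CM := phi @` (C `&` dom (charts M) i).
pose UN := psi @` (U l `&` dom (charts N) j).
pose G := [set row_mx (phi x) (psi (theta x)) |
  x in dom (charts M) i `&` theta @^-1` dom (charts N) j].
(* The condition in coordinates, ready for definable choice: [z] represents a point of [C] whose
   image is in the box of radius [e 0%N]. *)
pose P (e : nat -> R) z := CM z /\ exists w, G (row_mx z w) /\ UN w /\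
  forall k, psi y ord0 k - e 0%N < w ord0 k /\ w ord0 k < psi y ord0 k + e 0%N.
have DP : definable_pred S (fun e =>
    P (fun i0 => e (Defs.dim (charts M) i + i0)%N) (\row_k e k)).
  rewrite /P; prove_definable.
  - apply: (definable_pred_mem (definable_subspace_chart trM C_definable i)).
    by prove_definable_vec.
  - apply: (definable_pred_mem (ld_map_chart_graph trM trN ld_theta i j)).
    by prove_definable_vec.
  - apply: (definable_pred_mem (definable_subspace_chart trN def_Ul j)).
    by prove_definable_vec.
have [u Du Pu] := definable_choiceV S_omin DP.
pose f t := u (fun=> t).
have Df k : definable_fun S (fun e => f (e 0%N) ord0 k).
  exact: (definable_pred_ren (fun i => if i is j.+1 then 1 else 0)%N (Du k)).
have [c c0 f_cont] := definable_continuous_right_row S_omin 0 Df.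
have /choice[gamma gammaP] (t : R) : exists x, 0 < t ->
    [/\ C x, dom (charts M) i x, phi x = f t & near_y t (theta x)].
  (* For [t <= 0] nothing is required; any point of [M] serves, and [near_yP] supplies one. *)
  have [t0|t0] := ltP 0 t; last first.
    by have [x _] := near_yP 1 ltr01; exists x.
  have [x [Cx ix [jx Ulx xy]]] := near_yP t t0.
  have Pt : P (fun=> t) (phi x).
    split; first by exists x.
    by exists (psi (theta x)); split; [exists x|split => //; exists (theta x)].
  have [[x' [Cx' ix'] x'f] [w [[x1 [ix1 jx1] /eq_row_mx[x1f <-]]]]] := Pu _ _ Pt.
  move=> [[z [Ulz jz] zx1] x1y]; exists x' => _.
  (* Membership in [CM], [G] and [UN] yields a priori unrelated points [x'], [x1], [z]; injectivity
     of the charts gives [x1 = x'] and [z = theta x']. *)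
  have E : x1 = x' by apply: (chart_inj trM ix1 ix'); rewrite [RHS]x'f.
  rewrite {}E in jx1 zx1 x1y.
  by rewrite (chart_inj trN jz jx1 zx1) in Ulz.
have c2_gt0 : 0 < c / 2 by rewrite divr_gt0.
have c2_lt : c / 2 < c by rewrite ltr_pdivrMr// ltr_pMr// ltr1n.
(* The component of the preimage of [U l] containing the curve, based at its point of parameter
   [c / 2]. *)
pose D := [set x | ld_path (theta @^-1` U l) (gamma (c / 2)) x].
have Dgamma t : 0 < t -> t < c -> D (gamma t).
  move=> t0 tc; apply: (definable_curve_path Df f_cont) => // {t0 tc}t t0 tc.
  by have [_ it ft [_ Ut _]] := gammaP t t0.
have [_ _ [[_ injD surjD] _ openD]] : [/\ definable_subspace S (charts M) D,
    definable_map S (charts M) (charts N) D theta & homeo_on D (U l) theta].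
  apply: U_homeo; exists (gamma (c / 2)) => //.
  by have [_ _ _ []] := gammaP _ c2_gt0.
have [d Dd dy] := surjD y Uly.
exists d => //; apply: contrapT => nCd.
(* If the point [d] over [y] were outside [C], the image of [D] minus [C] would be a neighbourhood
   of [y] in [U l], as [theta] is open on [D]. *)
have openDC : open (theta @` (D `&` ~` C) : set (subspace (U l))).
  apply: openD; first exact: subIsetl.
  by rewrite open_subspaceTI; apply: open_subspaceW; exact: closed_openC.
have /open_subspaceP[W oW WU] := openDC.
have yW : nbhs y W.
  apply: open_nbhs_nbhs; split => //.
  suff : (W `&` U l) y by case.
  by rewrite WU; split => //; exists d.
have [r r0 rW] := chart_nbhs jy yW.
(* Below [c], so that [gamma t] lies in [D]; below [r], so that its image falls in the neighbourhood
   [W] of [y]. *)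
pose t := Num.min (c / 2) (r / 2).
have t0 : 0 < t by rewrite lt_min c2_gt0 divr_gt0.
have tc : t < c by rewrite gt_min c2_lt.
have r2_lt : r / 2 < r by rewrite ltr_pdivrMr// ltr_pMr// ltr1n.
have tr : t < r by rewrite gt_min r2_lt orbT.
have [Ct it ft [jt Ut ty]] := gammaP t t0.
have : (W `&` U l) (theta (gamma t)).
  split => //; apply: rW => //; split => // i0 k; rewrite (ord1 i0).
  by have [yt ty'] := ty k; rewrite /ball /= ltr_distlC; apply/andP; split; lra.
(* Injectivity of [theta] on [D] identifies [x], outside [C], with [gamma t], inside [C]. *)
rewrite WU => -[[x [Dx nCx] xt] _]; apply: nCx.
by rewrite (injD x (gamma t)) ?inE//; exact: Dgamma.
Unshelve. all: by end_near. Qed.
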